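(* Let $F_1,F_2,F_3,F_4$ be finite integral domains (i.e. finite fields) with $|F_i^*|=n_i$ for $i=1,2,3,4$ and $n_1\geq n_2\geq n_3\geq n_4$, and let $R=F_1\times F_2\times F_3\times F_4$. (i) If $n_1\geq n_2n_3n_4$, then $\alpha(\Gamma(R))=n_1(n_2n_3+n_2n_4+n_3n_4+n_2+n_3+n_4+1)$. (ii) If $n_1\leq n_2n_3n_4$ and $n_1n_4\geq n_2n_3$, then $\alpha(\Gamma(R))=n_1(n_2n_3+n_2n_4+n_3n_4+n_2+n_3+n_4)+n_2n_3n_4$. (iii) If $n_1n_4\leq n_2n_3$, then $\alpha(\Gamma(R))=n_1(n_2n_3+n_2n_4+n_3n_4+n_2+n_3)+n_2n_3+n_2n_3n_4$.
   Context: $F^*=F\setminus\{0\}$. For a commutative ring $R$ with $1\neq 0$, $\Gamma(R)$ is the simple undirected graph whose vertices are the nonzero zero-divisors of $R$, two distinct vertices $x,y$ being adjacent iff $xy=0$. $\alpha(G)$ is the independence number of a graph $G$ (maximum size of a set of pairwise non-adjacent vertices). *)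

(* Defs.v *)
From HB Require Import structures.
From mathcomp Require Import all_boot all_order all_algebra.

Set Implicit Arguments.
Unset Strict Implicit.
Unset Printing Implicit Defensive.

Import GRing.Theory.
Local Open Scope ring_scope.

(* The library does not join its product ring and product finType instances. *)
HB.instance Definition _ (A B : finComNzRingType) :=
  GRing.ComNzRing.on (A * B)%type.

Record sgraph := SGraph {
  vertex :> finType;
  adj : rel vertex;
  adj_sym : symmetric adj;
  adj_irrefl : irreflexive adj
}.

Definition independent (G : sgraph) (S : {set G}) : bool :=
  [forall x in S, forall y in S, (x != y) ==> ~~ adj x y].

(* set0 is always independent, so the maximum is never over an empty range. *)
Definition alpha (G : sgraph) : nat :=
  (\max_(S : {set G} | independent S) #|S|)%N.

Section ZeroDivisorGraph.
Variable R : finComNzRingType.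

Definition zero_divisor (x : R) : bool :=
  [exists y : R, (y != 0) && (x * y == 0)].

Definition zd_vertex : finType := {x : R | (x != 0) && zero_divisor x}.

Definition zd_adj (u v : zd_vertex) : bool :=
  (u != v) && (val u * val v == 0).

Lemma zd_adj_sym : symmetric zd_adj.
Proof. by move=> u v; rewrite /zd_adj eq_sym mulrC. Qed.

Lemma zd_adj_irrefl : irreflexive zd_adj.
Proof. by move=> u; rewrite /zd_adj eqxx. Qed.

Definition zd_graph : sgraph := SGraph zd_adj_sym zd_adj_irrefl.

End ZeroDivisorGraph.

(* Main.v *)
(** The support of an element of [F1 * F2 * F3 * F4] is the set of its nonzero
    coordinates; two vertices are adjacent iff their supports are disjoint.  An
    independent set never meets both the class of a support and that of its
    complement, so its size is at most the sum, over the seven complementary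
    pairs of supports, of the larger class.  In each of the three cases the
    larger classes come from pairwise intersecting supports, so the bound is
    attained. *)
Require Import Defs.
From mathcomp Require Import all_boot all_order all_algebra.
From mathcomp Require Import zify.

Set Implicit Arguments.
Unset Strict Implicit.
Unset Printing Implicit Defensive.

Import GRing.Theory.

(** Each vertex [u] of an independent [S] is filed under whichever of [s u] and [c (s u)] lies in
    [T]. Since class [b] is completely joined to class [c b], the part of [S] filed under [b] stays
    inside one of these two, hence is no larger than class [b]. Conversely, the union of the classes
    in [T] is itself independent. *)
Lemma alpha_complementary_classes (G : sgraph) (P : finType) (s : G -> P)
    (c : P -> P) (T : seq P) :
    involutive c -> uniq T ->
    (forall u v, s v = c (s u) -> adj u v) ->
    (forall u v, s u \in T -> s v \in T -> ~~ adj u v) ->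
    (forall u, (s u \in T) || (c (s u) \in T)) ->
    {in T, forall b, #|[set u | s u == c b]| <= #|[set u | s u == b]|} ->
  alpha G = \sum_(b <- T) #|[set u | s u == b]|.
Proof.
move=> cK uT adjc indT covT domT.
have card_fibres (S : {set G}) (r : G -> P) : {in S, forall u, r u \in T} ->
    #|S| = \sum_(b <- T) #|[set u in S | r u == b]|.
  move=> rT; rewrite -sum1_card (partition_big r (mem T)) //= -big_uniq //=.
  by apply: eq_bigr => b _; rewrite -sum1dep_card.
apply/eqP; rewrite eqn_leq; apply/andP; split.
  apply/bigmax_leqP => S /forall_inP indS.
  pose r u := if s u \in T then s u else c (s u).
  rewrite (card_fibres S r) => [|u _]; last first.
    by rewrite /r; have := covT u; case: ifP.
  rewrite !big_seq; apply: leq_sum => b bT.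
  have r_eq u : r u = b -> s u = b \/ s u = c b.
    by rewrite /r; case: ifP => _ <-; [left | right; rewrite cK].
  have [/exists_inP[v vS /eqP sv]|noS] := boolP [exists v in S, s v == c b].
    (* As [v] in [S] has label [c b], no vertex of [S] has label [b], so the whole fibre lies in the
       class of [c b]. *)
    apply: leq_trans (domT b bT); apply/subset_leq_card/subsetP => u.
    rewrite !inE => /andP[uS /eqP/r_eq[] su]; apply/eqP => //.
    have auv : adj u v by apply: adjc; rewrite sv su.
    have /forall_inP/(_ v vS) := indS u uS.
    have [uv|_ /=] := eqVneq u v; first by rewrite uv adj_irrefl in auv.
    by rewrite auv.
  apply/subset_leq_card/subsetP => u; rewrite !inE => /andP[uS /eqP/r_eq[]] su.
    by rewrite su.
  by case/exists_inP: noS; exists u => //; apply/eqP.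
pose S := [set u | s u \in T].
have -> : \sum_(b <- T) #|[set u | s u == b]| = #|S|.
  rewrite (card_fibres S s) => [|u]; last by rewrite inE.
  rewrite big_seq [RHS]big_seq; apply: eq_bigr => b bT; congr #|pred_of_set _|.
  by apply/setP => u; rewrite !inE; case: eqP => [->|]; rewrite ?bT ?andbF.
apply: (@leq_bigmax_cond _ (fun S : {set G} => independent S)
          (fun S : {set G} => #|S|)).
apply/forall_inP => u; rewrite inE => uT'; apply/forall_inP => v; rewrite inE.
by move=> vT; rewrite indT ?implybT.
Qed.

Definition pattern : Type := (bool * bool * bool * bool)%type.

Definition pattern_compl (b : pattern) : pattern :=
  let: (b1, b2, b3, b4) := b in (~~ b1, ~~ b2, ~~ b3, ~~ b4).

Definition pattern_meet (b c : pattern) : bool :=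
  let: (b1, b2, b3, b4) := b in let: (c1, c2, c3, c4) := c in
  [|| b1 && c1, b2 && c2, b3 && c3 | b4 && c4].

Definition pattern_proper (b : pattern) : bool :=
  (b != (true, true, true, true)) && (b != (false, false, false, false)).

Definition pattern_weight (n1 n2 n3 n4 : nat) (b : pattern) : nat :=
  let: (b1, b2, b3, b4) := b in
  (if b1 then n1 else 1) * (if b2 then n2 else 1)
    * (if b3 then n3 else 1) * (if b4 then n4 else 1).

(** A pattern never meets its complement, so such a [T] takes exactly one member of each
    complementary pair of proper patterns. *)
Definition intersecting_transversal (T : seq pattern) : Prop :=
  [/\ uniq T, all pattern_proper T, all2rel pattern_meet T
    & forall b, pattern_proper b -> (b \in T) || (pattern_compl b \in T)].

Lemma pattern_complK : involutive pattern_compl.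
Proof. by move=> [[[[] []] []] []]. Qed.

Lemma pattern_meet_compl (b : pattern) : ~~ pattern_meet b (pattern_compl b).
Proof. by move: b => [[[[] []] []] []]. Qed.

Lemma pattern_proper_compl (b : pattern) :
  pattern_proper (pattern_compl b) = pattern_proper b.
Proof. by move: b => [[[[] []] []] []]. Qed.

(** This mirrors, on supports, the definition of a vertex: [pattern_meet b b] says that [b] is
    nonempty, and [c] is the support of a nonzero annihilator, for which the complement of [b]
    serves. *)
Lemma pattern_properP (b : pattern) :
  reflect (exists2 c, pattern_meet b b & pattern_meet c c && ~~ pattern_meet b c)
          (pattern_proper b).
Proof.
apply: (iffP idP) => [pb|].
  by exists (pattern_compl b); move: b pb => [[[[] []] []] []].
by move: b => [[[[] []] []] []] [[[[[] []] []] []]].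
Qed.

Lemma card_neq0_eqb (F : finIdomainType) (b : bool) :
  #|[set x : F | (x != 0%R) == b]| = if b then #|[set x : F | x != 0%R]| else 1.
Proof.
case: b; first by apply: eq_card => x; rewrite !inE eqb_id.
by rewrite -(cards1 (0%R : F)); apply: eq_card => x; rewrite !inE eqbF_neg negbK.
Qed.

Section FourFactors.
Variables F1 F2 F3 F4 : finIdomainType.
Local Notation R := (F1 * F2 * F3 * F4)%type.
Local Notation weight := (pattern_weight
  #|[set x : F1 | x != 0%R]| #|[set x : F2 | x != 0%R]|
  #|[set x : F3 | x != 0%R]| #|[set x : F4 | x != 0%R]|).

Definition support_pattern (x : R) : pattern :=
  let: (x1, x2, x3, x4) := x in
  (x1 != 0%R, x2 != 0%R, x3 != 0%R, x4 != 0%R).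

(** A 0-1 element with prescribed support, which turns a pattern into a concrete annihilator. *)
Definition pattern_indicator (b : pattern) : R :=
  let: (b1, b2, b3, b4) := b in (b1%:R, b2%:R, b3%:R, b4%:R)%R.

Lemma pattern_indicatorK : cancel pattern_indicator support_pattern.
Proof.
by move=> [[[[] []] []] []]; rewrite /support_pattern /= ?oner_neq0 ?eqxx.
Qed.

Lemma mul_eq0_support (x y : R) :
  (x * y == 0)%R = ~~ pattern_meet (support_pattern x) (support_pattern y).
Proof.
move: x y => [[[x1 x2] x3] x4] [[[y1 y2] y3] y4].
by rewrite !xpair_eqE !mulf_eq0 /= !negb_or !negb_and !negbK -!andbA.
Qed.

Lemma neq0_support (x : R) :
  (x != 0)%R = pattern_meet (support_pattern x) (support_pattern x).
Proof.
by move: x => [[[x1 x2] x3] x4]; rewrite !xpair_eqE /= !andbb !negb_and !orbA.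
Qed.

Lemma vertex_support (x : R) :
  ((x != 0)%R && zero_divisor x) = pattern_proper (support_pattern x).
Proof.
apply/andP/pattern_properP => [[x0 /existsP[y /andP[y0 xy]]]|[c xx /andP[cc xc]]].
  by exists (support_pattern y); rewrite -?neq0_support -?mul_eq0_support ?y0.
rewrite neq0_support; split=> //; apply/existsP; exists (pattern_indicator c).
by rewrite neq0_support mul_eq0_support pattern_indicatorK cc.
Qed.

Lemma card_support (b : pattern) :
  #|[set x : R | support_pattern x == b]| = weight b.
Proof.
case: b => [[[b1 b2] b3] b4]; rewrite /pattern_weight -!card_neq0_eqb -!cardsX.
by apply: eq_card => -[[[x1 x2] x3] x4]; rewrite !inE /= !xpair_eqE.
Qed.

Lemma card_vertex_support (b : pattern) : pattern_proper b ->
  #|[set u : zd_graph R | support_pattern (val u) == b]| = weight b.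
Proof.
move=> pb; rewrite -card_support -(card_imset _ val_inj); apply: eq_card => x.
rewrite [in RHS]inE; apply/imsetP/eqP => [[u]|xb].
  by rewrite inE => /eqP ub ->.
have vx : (x != 0)%R && zero_divisor x by rewrite vertex_support xb.
by exists (Sub x vx); rewrite ?inE /= ?xb.
Qed.

(** The distinctness clause of adjacency is automatic: the ring is reduced, so a vertex never
    squares to zero. *)
Lemma zd_adj_support (u v : zd_graph R) :
  adj u v = ~~ pattern_meet (support_pattern (val u)) (support_pattern (val v)).
Proof.
rewrite -mul_eq0_support /= /zd_adj; case: eqVneq => //= ->.
by rewrite mul_eq0_support -neq0_support; case/andP: (valP v) => ->.
Qed.

Lemma alpha_intersecting_transversal (T : seq pattern) :
    intersecting_transversal T ->
    all (fun b => weight (pattern_compl b) <= weight b) T ->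
  alpha (zd_graph R) = \sum_(b <- T) weight b.
Proof.
move=> [uT /allP pT /allrelP meetT covT] /allP domT.
rewrite (@alpha_complementary_classes (zd_graph R) _
           (fun u => support_pattern (val u))
           pattern_compl T) //.
- by apply: eq_big_seq => b /pT/card_vertex_support.
- exact: pattern_complK.
- by move=> u v suv; rewrite zd_adj_support suv pattern_meet_compl.
- by move=> u v uT' vT; rewrite zd_adj_support negbK meetT.
- by move=> u; apply: covT; rewrite -vertex_support (valP u).
move=> b bT; rewrite !card_vertex_support ?pattern_proper_compl ?pT //.
exact: domT.
Qed.

End FourFactors.

Lemma card_neq0_gt0 (F : finIdomainType) : 0 < #|[set x : F | x != 0%R]|.
Proof. by apply/card_gt0P; exists 1%R; rewrite inE oner_neq0. Qed.

Theorem theorem10 (F1 F2 F3 F4 : finIdomainType) (n1 n2 n3 n4 : nat)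
    (hF1 : #|[set x : F1 | x != 0%R]| = n1)
    (hF2 : #|[set x : F2 | x != 0%R]| = n2)
    (hF3 : #|[set x : F3 | x != 0%R]| = n3)
    (hF4 : #|[set x : F4 | x != 0%R]| = n4)
    (h12 : n2 <= n1) (h23 : n3 <= n2) (h34 : n4 <= n3) :
  [/\ (n2 * n3 * n4 <= n1 ->
        alpha (zd_graph (F1 * F2 * F3 * F4)%type)
        = n1 * (n2 * n3 + n2 * n4 + n3 * n4 + n2 + n3 + n4 + 1)),
      (n1 <= n2 * n3 * n4 -> n2 * n3 <= n1 * n4 ->
        alpha (zd_graph (F1 * F2 * F3 * F4)%type)
        = n1 * (n2 * n3 + n2 * n4 + n3 * n4 + n2 + n3 + n4) + n2 * n3 * n4)
    & (n1 * n4 <= n2 * n3 ->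
        alpha (zd_graph (F1 * F2 * F3 * F4)%type)
        = n1 * (n2 * n3 + n2 * n4 + n3 * n4 + n2 + n3)
            + n2 * n3 + n2 * n3 * n4)].
Proof.
have [p1 p2 p3 p4] : [/\ 0 < n1, 0 < n2, 0 < n3 & 0 < n4].
  by rewrite -hF1 -hF2 -hF3 -hF4 !card_neq0_gt0.
(* These five of the seven comparisons follow from the ordering alone; only {1} against {2,3,4} and
   {1,4} against {2,3} depend on the case. *)
have h1234 : n3 * n4 <= n1 * n2 by apply: leq_mul; lia.
have h1324 : n2 * n4 <= n1 * n3 by apply: leq_mul; lia.
have h4123 : n4 <= n1 * n2 * n3 by nia.
have h3124 : n3 <= n1 * n2 * n4 by nia.
have h2134 : n2 <= n1 * n3 * n4 by nia.
split.
- move=> h1.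
  (* Chain: [n2 * n3 <= n2 * n3 * n4 <= n1 <= n1 * n4]. *)
  have h1423 : n2 * n3 <= n1 * n4 by nia.
  (* The star: all proper supports containing coordinate 1. *)
  rewrite (@alpha_intersecting_transversal _ _ _ _
    [:: (true, false, false, false); (true, true, false, false);
        (true, false, true, false); (true, false, false, true);
        (true, true, true, false); (true, true, false, true);
        (true, false, true, true)]).
  + by rewrite hF1 hF2 hF3 hF4 !big_cons big_nil /pattern_weight; nia.
  + by split=> // -[[[[] []] []] []].
  + by rewrite hF1 hF2 hF3 hF4 /= !muln1 !mul1n; lia.
- move=> h1 h1423.
  (* {2,3,4} replaces {1}; it meets every other support in the star, as each contains a second
     coordinate. *)
  rewrite (@alpha_intersecting_transversal _ _ _ _
    [:: (false, true, true, true); (true, true, false, false);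
        (true, false, true, false); (true, false, false, true);
        (true, true, true, false); (true, true, false, true);
        (true, false, true, true)]).
  + by rewrite hF1 hF2 hF3 hF4 !big_cons big_nil /pattern_weight; nia.
  + by split=> // -[[[[] []] []] []].
  + by rewrite hF1 hF2 hF3 hF4 /= !muln1 !mul1n; lia.
- move=> h1423.
  (* Chain: [n1 <= n1 * n4 <= n2 * n3 <= n2 * n3 * n4]. *)
  have h1 : n1 <= n2 * n3 * n4 by nia.
  (* {2,3} now also replaces {1,4}. These are the proper supports with at least two of the
     coordinates 1, 2, 3, so any two of them meet. *)
  rewrite (@alpha_intersecting_transversal _ _ _ _
    [:: (false, true, true, true); (true, true, false, false);
        (true, false, true, false); (false, true, true, false);
        (true, true, true, false); (true, true, false, true);
        (true, false, true, true)]).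
  + by rewrite hF1 hF2 hF3 hF4 !big_cons big_nil /pattern_weight; nia.
  + by split=> // -[[[[] []] []] []].
  + by rewrite hF1 hF2 hF3 hF4 /= !muln1 !mul1n; lia.
Qed.
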